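(* Let $f:\mathbb{C}_+\to\mathbb{C}_+$ be a function. The function $$\mathcal{C}_{\mathbb{D},2}:\mathbb{D}\to[0,2\pi),\qquad z\mapsto 2\cdot\arg\Big(i\cdot T_{\mathbb{D}}\big(\mathcal{M}\big(f(T_{\mathbb{D}}^{-1}(z))\big)\big)\Big)$$ assigns a unique color to the preimage of each hyperbolic line corresponding to a circle in $\mathbb{C}_+$ centered at $0$. That is, writing $S_r=\{w\in\mathbb{C}_+ : |w|=r\}$ for $r>0$ and $Q_r=\{z\in\mathbb{D} : f(T_{\mathbb{D}}^{-1}(z))\in S_r\}$: $\mathcal{C}_{\mathbb{D},2}$ takes values in $[0,2\pi)$, for every $r>0$ it is constant on $Q_r$, and if $r\neq r'$, $z\in Q_r$ and $z'\in Q_{r'}$, then $\mathcal{C}_{\mathbb{D},2}(z)\neq\mathcal{C}_{\mathbb{D},2}(z')$.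
   Context: $\mathbb{C}_+=\{w\in\mathbb{C}:\mathrm{Im}(w)>0\}$ is the upper half-plane model of hyperbolic space and $\mathbb{D}=\{z\in\mathbb{C}:|z|<1\}$ is the Poincaré disc. The map $T_{\mathbb{D}}$ is inversion in the circle $K$ of radius $\sqrt{2}$ centered at $-i$, followed by complex conjugation; explicitly $T_{\mathbb{D}}(w)=\frac{iw+1}{w+i}$. It maps $\mathbb{C}_+$ bijectively and conformally onto $\mathbb{D}$, with inverse $T_{\mathbb{D}}^{-1}:\mathbb{D}\to\mathbb{C}_+$ (conjugation followed by inversion in $K$). The same formula is used to apply $T_{\mathbb{D}}$ to real numbers, which it sends to the unit circle. $\mathcal{M}(w)=|w|$ is the modulus map. $\arg$ denotes the argument of a nonzero complex number, taken in $[0,2\pi)$; the values of $\mathcal{C}_{\mathbb{D},2}$ are regarded as colors on the color wheel. The hyperbolic lines corresponding to circles centered at $0$ are represented in $\mathbb{C}_+$ by the semicircles $S_r$, $r>0$; the preimage of such a line is the set of points $z\in\mathbb{D}$ such that $f(T_{\mathbb{D}}^{-1}(z))$ lies on the corresponding semicircle. No regularity is assumed of $f$. *)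

(* Defs.v *)
From Stdlib Require Import Reals Lra ClassicalEpsilon.
From Coquelicot Require Import Coquelicot.
Open Scope R_scope.

Definition half_plane : Type := {w : C | 0 < Im w}.
Definition unit_disc : Type := {z : C | Cmod z < 1}.
Definition half_plane_val (w : half_plane) : C := proj1_sig w.
Definition unit_disc_val (z : unit_disc) : C := proj1_sig z.
Coercion half_plane_val : half_plane >-> C.
Coercion unit_disc_val : unit_disc >-> C.

Definition is_arg (z : C) (t : R) : Prop :=
  0 <= t < 2 * PI /\ z = (RtoC (Cmod z) * (cos t, sin t))%C.

(** At [z = 0] every [t] in range qualifies, so [arg 0] is an unspecified
    element of the range. *)
Definition arg (z : C) : R := epsilon (inhabits 0) (is_arg z).

Lemma is_arg_exists (z : C) : exists t, is_arg z t.
Proof.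
destruct (Ceq_dec z 0) as [->|hz].
{ exists 0; split; [pose proof PI_RGT_0; lra|].
  rewrite Cmod_0; now rewrite Cmult_0_l. }
pose proof PI_RGT_0 as hpi.
destruct z as [x y].
pose proof (proj1 (Cmod_gt_0 _) hz) as hm.
assert (hsq : Cmod (x, y) * Cmod (x, y) = x * x + y * y).
{ unfold Cmod; simpl; rewrite sqrt_sqrt by nra; ring. }
set (m := Cmod (x, y)) in *.
assert (hu : -1 <= x / m <= 1).
{ assert (x / m * m = x) by (field; lra). split; apply Rmult_le_reg_r with m; nra. }
pose proof (acos_bound (x / m)) as hb.
assert (hy : sin (acos (x / m)) = Rabs y / m).
{ rewrite sin_acos by exact hu.
  replace (1 - (x / m)²) with ((Rabs y / m)²).
  - apply sqrt_Rsqr. apply Rmult_le_pos; [apply Rabs_pos|].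
    left; now apply Rinv_0_lt_compat.
  - assert (h1 : (Rabs y)² = y * y) by (rewrite <- Rsqr_abs; reflexivity).
    unfold Rdiv; rewrite !Rsqr_mult, h1; unfold Rsqr.
    replace (y * y) with (m * m - x * x) by lra. field; lra. }
destruct (Rle_lt_dec 0 y) as [h|h].
- exists (acos (x / m)); split; [lra|].
  rewrite cos_acos, hy, Rabs_right by lra.
  apply injective_projections; simpl; fold m; field; lra.
- exists (2 * PI - acos (x / m)).
  rewrite Rabs_left in hy by lra.
  assert (h0 : acos (x / m) <> 0).
  { intros e; rewrite e, sin_0 in hy.
    assert (- y / m * m = - y) by (field; lra). nra. }
  split; [lra|].
  assert (hc : cos (2 * PI - acos (x / m)) = x / m).
  { rewrite cos_minus, cos_2PI, sin_2PI, cos_acos by lra; ring. }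
  assert (hs : sin (2 * PI - acos (x / m)) = y / m).
  { rewrite sin_minus, cos_2PI, sin_2PI, hy; field; lra. }
  rewrite hc, hs.
  apply injective_projections; simpl; fold m; field; lra.
Qed.

Lemma argP (z : C) : is_arg z (arg z).
Proof. exact (epsilon_spec _ _ (is_arg_exists z)). Qed.

Lemma is_arg_unique (z : C) (t t' : R) :
  z <> 0%C -> is_arg z t -> is_arg z t' -> t = t'.
Proof.
intros hz [ht e] [ht' e'].
pose proof (proj1 (Cmod_gt_0 _) hz) as hm.
assert (hE : (RtoC (Cmod z) * (cos t, sin t) = RtoC (Cmod z) * (cos t', sin t'))%C)
  by congruence.
injection hE; simpl; intros hs hc.
assert (hc' : cos t = cos t') by (apply Rmult_eq_reg_l with (Cmod z); lra).
assert (hs' : sin t = sin t') by (apply Rmult_eq_reg_l with (Cmod z); lra).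
assert (hcd : cos (t - t') = 1).
{ rewrite cos_minus, hc', hs'. pose proof (sin2_cos2 t'). unfold Rsqr in *; lra. }
assert (hsh : sin ((t - t') / 2) = 0).
{ assert (h2 : t - t' = 2 * ((t - t') / 2)) by field.
  rewrite h2, cos_2a_sin in hcd. nra. }
assert (hlt : - PI < (t - t') / 2 < PI) by lra.
destruct (Rtotal_order ((t - t') / 2) 0) as [h|[h|h]]; [|lra|].
- assert (0 < sin (- ((t - t') / 2))) by (apply sin_gt_0; lra).
  rewrite sin_neg in *; lra.
- assert (0 < sin ((t - t') / 2)) by (apply sin_gt_0; lra). lra.
Qed.

(** [inversion c rho w = c + rho^2 (w - c) / |w - c|^2] *)
Definition inversion (c : C) (rho : R) (w : C) : C :=
  (c + RtoC (rho ^ 2) / Cconj (w - c))%C.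

(** Applied to [half_plane] and, with the same formula, to real numbers. *)
Definition T_D (w : C) : C := ((Ci * w + 1) / (w + Ci))%C.

(** Conjugation, then inversion in the circle of centre [- Ci] and radius
    [sqrt 2]; [T_D_Cmod], [T_DK] and [T_D_invK] show that it is
    the inverse of [T_D] from the half-plane to the disc. *)
Definition T_D_inv_fun (z : C) : C := inversion (- Ci)%C (sqrt 2) (Cconj z).

Lemma T_D_inversion (w : C) :
  w <> (- Ci)%C -> T_D w = Cconj (inversion (- Ci)%C (sqrt 2) w).
Proof.
intros hw; unfold T_D, inversion.
assert (h : (w + Ci)%C <> 0%C).
{ intros e; apply hw.
  replace w with ((w + Ci) - Ci)%C by ring. rewrite e; ring. }
assert (h' : (w - - Ci)%C = (w + Ci)%C) by ring.
rewrite pow2_sqrt, h' by lra.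
unfold Cdiv.
rewrite Cplus_conj, Cmult_conj, Cinv_conj, Cconj_conj by
  (intros e; apply h; apply (f_equal Cconj) in e;
   rewrite Cconj_conj in e; rewrite e; apply injective_projections; simpl; ring).
replace (Cconj (- Ci)) with Ci by (apply injective_projections; simpl; ring).
replace (Cconj (RtoC 2)) with (RtoC 2) by (apply injective_projections; simpl; ring).
replace (Ci * w + 1)%C with (Ci * (w + Ci) + 2)%C
  by (apply injective_projections; simpl; ring).
field; exact h.
Qed.

Lemma T_D_inv_funE (z : C) :
  T_D_inv_fun z = (- Ci + 2 / (z - Ci))%C.
Proof.
unfold T_D_inv_fun, inversion.
rewrite pow2_sqrt by lra.
replace (Cconj (Cconj z - - Ci)) with (z - Ci)%C; [reflexivity|].
apply injective_projections; simpl; ring.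
Qed.

Lemma disc_neq_Ci (z : C) : Cmod z < 1 -> (z - Ci)%C <> 0%C.
Proof.
intros h e.
assert (ez : z = Ci) by (replace z with ((z - Ci) + Ci)%C by ring; rewrite e; ring).
rewrite ez in h; unfold Cmod in h; simpl in h.
replace (0 * (0 * 1) + 1 * (1 * 1)) with 1 in h by ring.
rewrite sqrt_1 in h; lra.
Qed.

Lemma T_D_inv_Im (z : C) : Cmod z < 1 -> 0 < Im (T_D_inv_fun z).
Proof.
intros h; pose proof (disc_neq_Ci z h) as hz.
rewrite T_D_inv_funE.
destruct z as [x y].
assert (hxy : x * x + y * y < 1).
{ pose proof (Cmod_ge_0 (x, y)).
  assert (Cmod (x, y) * Cmod (x, y) = x * x + y * y)
    by (unfold Cmod; simpl; rewrite sqrt_sqrt by nra; ring).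
  nra. }
assert (hd : 0 < x * x + (y - 1) * (y - 1)) by nra.
replace (Im (- Ci + 2 / ((x, y) - Ci))%C)
  with ((1 - (x * x + y * y)) / (x * x + (y - 1) * (y - 1))).
- apply Rdiv_lt_0_compat; lra.
- simpl; field; nra.
Qed.

Definition T_D_inv (z : unit_disc) : half_plane :=
  exist _ (T_D_inv_fun z) (T_D_inv_Im z (proj2_sig z)).

Lemma T_D_Cmod (w : half_plane) : Cmod (T_D w) < 1.
Proof.
destruct w as [[x y] hw]; simpl; unfold T_D; simpl in hw.
assert (h : ((x, y) + Ci)%C <> 0%C).
{ intros e; apply (f_equal Im) in e; simpl in e; lra. }
rewrite Cmod_div by exact h.
pose proof (proj1 (Cmod_gt_0 _) h) as hm.
apply Rmult_lt_reg_r with (1 := hm).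
unfold Rdiv; rewrite Rmult_assoc, Rinv_l, Rmult_1_l, Rmult_1_r by lra.
unfold Cmod; simpl; apply sqrt_lt_1_alt.
split; ring_simplify; [|lra].
pose proof (pow2_ge_0 x); pose proof (pow2_ge_0 (y - 1)); lra.
Qed.

Lemma T_DK (w : half_plane) : T_D_inv_fun (T_D w) = w.
Proof.
destruct w as [w hw]; simpl; rewrite T_D_inv_funE; unfold T_D.
assert (h : (w + Ci)%C <> 0%C).
{ intros e; apply (f_equal Im) in e; unfold Im in *; simpl in *; lra. }
assert (e : ((Ci * w + 1) / (w + Ci) - Ci)%C = (2 / (w + Ci))%C).
{ replace (Ci * w + 1)%C with (Ci * (w + Ci) + 2)%C
    by (apply injective_projections; simpl; ring).
  field; exact h. }
rewrite e; field; exact h.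
Qed.

Lemma T_D_invK (z : unit_disc) : T_D (T_D_inv z) = z.
Proof.
destruct z as [z hz]; simpl; rewrite T_D_inv_funE; unfold T_D.
pose proof (disc_neq_Ci z hz) as h.
assert (h2 : RtoC 2 <> 0%C)
  by (intros e2; apply (f_equal Re) in e2; unfold Re in e2; simpl in e2; lra).
replace (Ci * (- Ci + 2 / (z - Ci)) + 1)%C with ((2 / (z - Ci)) * z)%C.
- replace (- Ci + 2 / (z - Ci) + Ci)%C with (2 / (z - Ci))%C by ring.
  field; repeat split; assumption.
- replace (Ci * (- Ci + 2 / (z - Ci)) + 1)%C
    with (2 + Ci * (2 / (z - Ci)))%C.
  + replace z with ((z - Ci) + Ci)%C at 2 by ring. field; exact h.
  + replace (RtoC 2) with (- (Ci * Ci) + 1)%C at 1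
      by (apply injective_projections; simpl; ring). ring.
Qed.

Definition modulus_map (w : half_plane) : R := Cmod w.

Definition color_D2 (f : half_plane -> half_plane) (z : unit_disc) : R :=
  2 * arg (Ci * T_D (RtoC (modulus_map (f (T_D_inv z)))))%C.

Definition semicircle (r : R) (w : half_plane) : Prop := Cmod w = r.

Definition line_preimage (f : half_plane -> half_plane) (r : R) (z : unit_disc) : Prop :=
  semicircle r (f (T_D_inv z)).

(* Main.v *)
Require Import Defs.
From Stdlib Require Import Reals Lra.
From Coquelicot Require Import Coquelicot.
Open Scope R_scope.

(** The rotated Cayley transform [w |-> Ci * T_D w] sends a real number [r] to
    [(1 + r * Ci) / (1 - r * Ci)].  Numerator and denominator are conjugate, so
    this quotient lies on the unit circle, at twice the argument of
    [1 + r * Ci], that is at the angle [2 * atan r] ([Ci_T_D_real]).  For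
    [0 <= r] this angle is nonnegative and less than [PI], hence is the value of
    [arg] ([arg_Ci_T_D_real]), and doubling it still gives less than [2 * PI].
    The color of [z] is therefore [4 * atan r] with [r] the modulus of
    [f (T_D_inv z)] ([color_D2_atan]): it depends on [r] alone, and determines
    [r] because [tan] inverts [atan]. *)

(** In coordinates [Ci * T_D r] is [(1 - r^2, 2 * r) / (1 + r^2)], the rational
    parametrization of the unit circle by the tangent [r] of the half-angle. *)
Lemma Ci_T_D_real (r : R) :
  (Ci * T_D (RtoC r))%C = (cos (2 * atan r), sin (2 * atan r)).
Proof.
pose proof (atan_bound r) as ht.
assert (hc : 0 < cos (atan r)) by (apply cos_gt_0; lra).
pose proof (sin2_cos2 (atan r)) as hsc; unfold Rsqr in hsc.
assert (hs : sin (atan r) = r * cos (atan r)).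
{ pose proof (tan_atan r) as h; unfold tan in h.
  rewrite <- h at 2; field; lra. }
assert (hd : 0 < 1 + r * r) by nra.
assert (hc2 : cos (atan r) * cos (atan r) = / (1 + r * r)).
{ rewrite hs in hsc.
  apply Rmult_eq_reg_l with (1 + r * r); [|lra].
  rewrite Rinv_r by lra; lra. }
rewrite cos_2a, sin_2a, hs.
replace (2 * (r * cos (atan r)) * cos (atan r))
  with (2 * r * (cos (atan r) * cos (atan r))) by ring.
replace (cos (atan r) * cos (atan r) - r * cos (atan r) * (r * cos (atan r)))
  with ((1 - r * r) * (cos (atan r) * cos (atan r))) by ring.
rewrite hc2; unfold T_D.
apply injective_projections; simpl; field; nra.
Qed.

Lemma Cmod_cos_sin (t : R) : Cmod (cos t, sin t) = 1.
Proof.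
unfold Cmod; simpl; rewrite !Rmult_1_r, Rplus_comm.
change (sqrt ((sin t)² + (cos t)²) = 1).
now rewrite sin2_cos2, sqrt_1.
Qed.

Lemma arg_cos_sin (t : R) : 0 <= t < 2 * PI -> arg (cos t, sin t) = t.
Proof.
intros ht; apply is_arg_unique with (cos t, sin t).
- intros e; pose proof (Cmod_cos_sin t) as h.
  rewrite e, Cmod_0 in h; lra.
- apply argP.
- split; [exact ht|].
  now rewrite Cmod_cos_sin, Cmult_1_l.
Qed.

Lemma atan_ge_0 (r : R) : 0 <= r -> 0 <= atan r.
Proof.
intros [h|<-].
- rewrite <- atan_0; left; now apply atan_increasing.
- rewrite atan_0; lra.
Qed.

(** The sign condition places the angle [2 * atan r] in the range of [arg];
    for [r < 0] the value would be [2 * atan r + 2 * PI]. *)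
Lemma arg_Ci_T_D_real (r : R) :
  0 <= r -> arg (Ci * T_D (RtoC r))%C = 2 * atan r.
Proof.
intros hr; rewrite Ci_T_D_real; apply arg_cos_sin.
pose proof (atan_ge_0 r hr); pose proof (atan_bound r); lra.
Qed.

Lemma color_D2_atan (f : half_plane -> half_plane) (z : unit_disc) :
  color_D2 f z = 4 * atan (Cmod (f (T_D_inv z))).
Proof.
unfold color_D2, modulus_map.
rewrite arg_Ci_T_D_real by apply Cmod_ge_0; ring.
Qed.

Theorem theorem2 (f : half_plane -> half_plane) :
  (forall z : unit_disc, 0 <= color_D2 f z < 2 * PI) /\
  (forall r : R, 0 < r ->
     forall z z' : unit_disc,
       line_preimage f r z -> line_preimage f r z' ->
       color_D2 f z = color_D2 f z') /\
  (forall r r' : R, 0 < r -> 0 < r' -> r <> r' ->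
     forall z z' : unit_disc,
       line_preimage f r z -> line_preimage f r' z' ->
       color_D2 f z <> color_D2 f z').
Proof.
unfold line_preimage, semicircle.
split; [|split].
- intros z; rewrite color_D2_atan.
  pose proof (atan_ge_0 _ (Cmod_ge_0 (f (T_D_inv z)))).
  pose proof (atan_bound (Cmod (f (T_D_inv z)))); lra.
- intros r _ z z' hz hz'.
  now rewrite !color_D2_atan, hz, hz'.
- intros r r' _ _ hne z z' hz hz'.
  rewrite !color_D2_atan, hz, hz'.
  intros e; apply hne.
  rewrite <- (tan_atan r), <- (tan_atan r'); f_equal; lra.
Qed.
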